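(* The axiom DIM is not provable in RCA$_0$ + VSMALL; i.e., there is an $\omega$-model of RCA$_0$ + VSMALL in which DIM fails.
   Context: A tree is a subset of $2^{<\mathbb{N}}$ closed under initial segments. A node $\sigma\in T$ is extendible if $\{\tau\in T:\tau\supseteq\sigma\}$ is infinite; $\mathrm{Ext}(T)$ is the set of extendible nodes. $\sigma\in T$ is a branching node if $\sigma0$ and $\sigma1$ are both extendible; $\mathrm{Br}(T)$ is the set of branching nodes. VSMALL is the axiom: if $T$ is an infinite binary tree such that there is no function $f:\mathbb{N}\to\mathbb{N}$ such that for infinitely many $n$ the set $\{|\sigma|:\sigma\in\mathrm{Br}(T),\ |\sigma|<f(n)\}$ has at least $n$ elements, then $T$ has an infinite path. DIM is the axiom: if $T$ is an infinite binary tree such that there is no function $f:\mathbb{N}\to\mathbb{N}$ with $\forall\sigma\in\mathrm{Ext}(T)\ \exists\tau\in\mathrm{Br}(T)\,[\tau\supseteq\sigma\wedge|\tau|\le f(|\sigma|)]$, then $T$ has an infinite path. *)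

(* Defs.v *)
(* Computability-theoretic setting: omega-models of RCA_0 are
   exactly Turing ideals (Simpson, SOSOA, VIII.1).  We define oracle
   (mu-)recursive computation, Turing reducibility, Turing ideals, and the
   relativisations of VSMALL and DIM to a collection M of sets of naturals. *)
From Stdlib Require Import List Arith PeanoNat.
Import ListNotations.

Definition set_nat := nat -> bool.

(** * Oracle mu-recursive terms (arguments are lists; missing ones read as 0) *)
Inductive rterm : Type :=
| RZero
| RSucc
| RProj (i : nat)
| ROracle
| RComp (f : rterm) (gs : list rterm)
| RPrec (g h : rterm)
| RMu (f : rterm).

Inductive eval (X : set_nat) : rterm -> list nat -> nat -> Prop :=
| ev_zero args : eval X RZero args 0
| ev_succ args : eval X RSucc args (S (hd 0 args))
| ev_proj i args : eval X (RProj i) args (nth i args 0)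
| ev_oracle args : eval X ROracle args (if X (hd 0 args) then 1 else 0)
| ev_comp f gs args vs v :
    evals X gs args vs -> eval X f vs v -> eval X (RComp f gs) args v
| ev_prec0 g h xs v : eval X g xs v -> eval X (RPrec g h) (0 :: xs) v
| ev_precS g h n xs u v :
    eval X (RPrec g h) (n :: xs) u -> eval X h (n :: u :: xs) v ->
    eval X (RPrec g h) (S n :: xs) v
| ev_mu f args n :
    eval X f (n :: args) 0 ->
    (forall m, m < n -> exists k, eval X f (m :: args) (S k)) ->
    eval X (RMu f) args n
with evals (X : set_nat) : list rterm -> list nat -> list nat -> Prop :=
| evs_nil args : evals X [] args []
| evs_cons g gs args v vs :
    eval X g args v -> evals X gs args vs -> evals X (g :: gs) args (v :: vs).

Definition turing_le (Y X : set_nat) : Prop :=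
  exists t : rterm, forall n, eval X t [n] (if Y n then 1 else 0).

Definition tjoin (X Y : set_nat) : set_nat :=
  fun n => if Nat.even n then X (Nat.div2 n) else Y (Nat.div2 n).

(** omega-models of RCA_0 = Turing ideals *)
Definition turing_ideal (M : set_nat -> Prop) : Prop :=
  (exists X, M X) /\
  (forall X Y, M X -> M Y -> M (tjoin X Y)) /\
  (forall X Y, M X -> turing_le Y X -> M Y).

(** Cantor pairing *)
Definition pair (n m : nat) : nat := Nat.div ((n + m) * (n + m + 1)) 2 + m.

Definition fun_in (M : set_nat -> Prop) (f : nat -> nat) : Prop :=
  exists G, M G /\ forall n m, G (pair n m) = true <-> f n = m.

(** Bijective coding of binary strings by naturals *)
Fixpoint code (s : list bool) : nat :=
  match s with
  | [] => 0
  | b :: s' => 2 * code s' + (if b then 2 else 1)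
  end.

Definition tree_of (X : set_nat) : list bool -> Prop := fun s => X (code s) = true.

Definition prefix (s t : list bool) : Prop := exists r, t = s ++ r.

Definition infinite_strs (P : list bool -> Prop) : Prop :=
  ~ exists l : list (list bool), forall t, P t -> In t l.

Definition is_tree (T : list bool -> Prop) : Prop :=
  forall s t, T t -> prefix s t -> T s.

Definition infinite_tree (T : list bool -> Prop) : Prop :=
  is_tree T /\ infinite_strs T.

Definition Ext (T : list bool -> Prop) (s : list bool) : Prop :=
  T s /\ infinite_strs (fun t => T t /\ prefix s t).

Definition Br (T : list bool -> Prop) (s : list bool) : Prop :=
  T s /\ Ext T (s ++ [false]) /\ Ext T (s ++ [true]).

Definition init_seg (X : set_nat) (n : nat) : list bool := map X (seq 0 n).

Definition has_path_in (M : set_nat -> Prop) (T : list bool -> Prop) : Prop :=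
  exists P, M P /\ forall n, T (init_seg P n).

Definition br_lengths_at_least (T : list bool -> Prop) (k n : nat) : Prop :=
  exists ls : list nat, NoDup ls /\ length ls = n /\
    forall l, In l ls -> l < k /\ exists s, Br T s /\ length s = l.

Definition VSMALL_in (M : set_nat -> Prop) : Prop :=
  forall X, M X -> infinite_tree (tree_of X) ->
    (~ exists f, fun_in M f /\
         forall m, exists n, m <= n /\ br_lengths_at_least (tree_of X) (f n) n) ->
    has_path_in M (tree_of X).

Definition DIM_in (M : set_nat -> Prop) : Prop :=
  forall X, M X -> infinite_tree (tree_of X) ->
    (~ exists f, fun_in M f /\
         forall s, Ext (tree_of X) s ->
           exists t, Br (tree_of X) t /\ prefix s t /\ length t <= f (length s)) ->
    has_path_in M (tree_of X).

(* Main.v *)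
(** The ideal consists of the sets computable from finitely many columns of a point [z] of
    Baire space that meets countably many dense open requirements.  Column 0 enumerates two
    disjoint sets A and B, and the tree T refuting DIM consists of the strings compatible with
    what has been enumerated so far, so its paths are the sets separating A and B, and it
    branches exactly at the levels outside A and B.  "Never enumerated" is a finite piece of
    information about [z], but it may be revised by a sufficiently late enumeration without
    disturbing a given halting computation from T.  Hence once a would-be path has been
    computed at an undecided number, that number can be enumerated into the wrong set; and once
    a bound f(n) on the distance to the next branching has been computed, everything in
    [n, f(n)] can be enumerated.  VSMALL holds for a different reason: column k+1 is generic
    over the earlier columns, so for a tree computable from them it is infinitely often above
    the function giving the n-th branching level, unless there are only finitely many
    branching levels, and then the tree has an isolated, hence computable, path. *)

From Stdlib Require Import List Arith Lia Bool Cantor ClassicalEpsilon.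
Require Import Defs.
Import ListNotations.

(** * Oracle computations *)

Section EvalInduction.

Variable X : set_nat.
Variable P : rterm -> list nat -> nat -> Prop.
Variable Q : list rterm -> list nat -> list nat -> Prop.
Hypothesis Hzero : forall a, P RZero a 0.
Hypothesis Hsucc : forall a, P RSucc a (S (hd 0 a)).
Hypothesis Hproj : forall i a, P (RProj i) a (nth i a 0).
Hypothesis Horacle : forall a, P ROracle a (if X (hd 0 a) then 1 else 0).
Hypothesis Hcomp : forall f gs a vs v,
  Q gs a vs -> P f vs v -> P (RComp f gs) a v.
Hypothesis Hprec0 : forall g h xs v, P g xs v -> P (RPrec g h) (0 :: xs) v.
Hypothesis HprecS : forall g h n xs u v,
  P (RPrec g h) (n :: xs) u -> P h (n :: u :: xs) v -> P (RPrec g h) (S n :: xs) v.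
Hypothesis Hmu : forall f a n,
  P f (n :: a) 0 -> (forall m, m < n -> exists k, P f (m :: a) (S k)) ->
  P (RMu f) a n.
Hypothesis Hnil : forall a, Q [] a [].
Hypothesis Hcons : forall g gs a v vs,
  P g a v -> Q gs a vs -> Q (g :: gs) a (v :: vs).

(* The generated schemes give no induction hypothesis under the existential of [ev_mu]. *)
Fixpoint eval_nested_ind t a v (e : eval X t a v) {struct e} : P t a v :=
  match e with
  | ev_zero _ a => Hzero a
  | ev_succ _ a => Hsucc a
  | ev_proj _ i a => Hproj i a
  | ev_oracle _ a => Horacle a
  | ev_comp _ f gs a vs v es e =>
      Hcomp f gs a vs v (evals_nested_ind gs a vs es) (eval_nested_ind f vs v e)
  | ev_prec0 _ g h xs v e => Hprec0 g h xs v (eval_nested_ind _ _ _ e)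
  | ev_precS _ g h n xs u v e1 e2 =>
      HprecS g h n xs u v (eval_nested_ind _ _ _ e1) (eval_nested_ind _ _ _ e2)
  | ev_mu _ f a n e H =>
      Hmu f a n (eval_nested_ind _ _ _ e)
        (fun m Hm =>
           match H m Hm with
           | ex_intro _ k e' => ex_intro _ k (eval_nested_ind _ _ _ e')
           end)
  end
with evals_nested_ind gs a vs (e : evals X gs a vs) {struct e} : Q gs a vs :=
  match e with
  | evs_nil _ a => Hnil a
  | evs_cons _ g gs a v vs e es =>
      Hcons g gs a v vs (eval_nested_ind _ _ _ e) (evals_nested_ind _ _ _ es)
  end.

End EvalInduction.

Lemma eval_fun X t a v : eval X t a v -> forall w, eval X t a w -> v = w.
Proof.
revert t a v.
apply (eval_nested_ind X (fun t a v => forall w, eval X t a w -> v = w)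
         (fun gs a vs => forall ws, evals X gs a ws -> vs = ws)).
- intros a w H; now inversion H.
- intros a w H; now inversion H.
- intros i a w H; now inversion H.
- intros a w H; now inversion H.
- intros f gs a vs v IHs IH w H; inversion H; subst.
  match goal with E : evals _ _ _ _ |- _ => apply IHs in E; subst end; auto.
- intros g h xs v IH w H; inversion H; subst; auto.
- intros g h n xs u v IH1 IH2 w H; inversion H; subst.
  match goal with E : eval _ (RPrec _ _) _ _ |- _ => apply IH1 in E; subst end; auto.
- intros f a n IH IHm w H; inversion H as [| | | | | | |? ? ? H0 Hlow]; subst.
  destruct (lt_eq_lt_dec n w) as [[Hlt|Heq]|Hlt]; auto; exfalso.
  + destruct (Hlow n Hlt) as [k Hk]; now apply IH in Hk.
  + destruct (IHm w Hlt) as [k Hk]; now apply Hk in H0.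
- intros a ws H; now inversion H.
- intros g gs a v vs IH IHs ws H; inversion H; subst.
  f_equal; auto.
Qed.

Lemma uniform_bound_list A (P : A -> nat -> Prop) l :
  (forall a u u', u <= u' -> P a u -> P a u') ->
  (forall a, In a l -> exists u, P a u) ->
  exists u, forall a, In a l -> P a u.
Proof.
intros Hmono; induction l as [|b l IH]; intros H; [exists 0; easy|].
destruct IH as [u Hu]; [intros a Ha; apply H; now right|].
destruct (H b) as [u' Hu']; [now left|].
exists (max u u'); intros a [<-|Ha].
- apply (Hmono _ u'); auto; lia.
- apply (Hmono _ u); [lia|auto].
Qed.

Lemma uniform_bound (P : nat -> nat -> Prop) n :
  (forall m u u', u <= u' -> P m u -> P m u') ->
  (forall m, m < n -> exists u, P m u) ->
  exists u, forall m, m < n -> P m u.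
Proof.
intros Hmono H.
destruct (uniform_bound_list _ P (seq 0 n) Hmono) as [u Hu].
- intros m Hm; apply in_seq in Hm; apply H; lia.
- exists u; intros m Hm; apply Hu, in_seq; lia.
Qed.

Definition agree_below (u : nat) (X Y : set_nat) : Prop :=
  forall c, c < u -> X c = Y c.

Lemma agree_below_le u u' X Y : u <= u' -> agree_below u' X Y -> agree_below u X Y.
Proof. intros Hu H c Hc; apply H; lia. Qed.

(** The use principle: a halting computation queries finitely many oracle bits. For [RMu] each of
    the [n] failed tests has its own use, and these are merged. *)
Lemma eval_use X t a v :
  eval X t a v -> exists u, forall Y, agree_below u X Y -> eval Y t a v.
Proof.
revert t a v.
apply (eval_nested_ind X
         (fun t a v => exists u, forall Y, agree_below u X Y -> eval Y t a v)
         (fun gs a vs => exists u, forall Y, agree_below u X Y -> evals Y gs a vs)).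
- exists 0; constructor.
- exists 0; constructor.
- exists 0; constructor.
- intros a; exists (S (hd 0 a)); intros Y HY.
  rewrite (HY (hd 0 a)) by lia; constructor.
- intros f gs a vs v [u1 H1] [u2 H2]; exists (max u1 u2); intros Y HY.
  econstructor; [apply H1|apply H2]; eapply agree_below_le; try apply HY; lia.
- intros g h xs v [u H]; exists u; intros Y HY; constructor; auto.
- intros g h n xs u v [u1 H1] [u2 H2]; exists (max u1 u2); intros Y HY.
  econstructor; [apply H1|apply H2]; eapply agree_below_le; try apply HY; lia.
- intros f a n [u1 H1] H2.
  destruct (uniform_bound
    (fun m u => forall Y, agree_below u X Y -> exists k, eval Y f (m :: a) (S k)) n)
    as [u2 Hu2].
  + intros m u u' Hu H Y HY; apply H; eapply agree_below_le; eauto.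
  + intros m Hm; destruct (H2 m Hm) as [k [u Hu]].
    exists u; intros Y HY; exists k; auto.
  + exists (max u1 u2); intros Y HY; constructor.
    * apply H1; eapply agree_below_le; try apply HY; lia.
    * intros m Hm; apply Hu2; auto; eapply agree_below_le; try apply HY; lia.
- exists 0; constructor.
- intros g gs a v vs [u1 H1] [u2 H2]; exists (max u1 u2); intros Y HY.
  constructor; [apply H1|apply H2]; eapply agree_below_le; try apply HY; lia.
Qed.

Fixpoint oracle_subst (r t : rterm) : rterm :=
  match t with
  | ROracle => RComp r [RProj 0]
  | RComp f gs => RComp (oracle_subst r f) (map (oracle_subst r) gs)
  | RPrec g h => RPrec (oracle_subst r g) (oracle_subst r h)
  | RMu f => RMu (oracle_subst r f)
  | _ => t
  end.

Lemma eval_oracle_subst (X Y : set_nat) r t a v :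
  (forall n, eval X r [n] (if Y n then 1 else 0)) ->
  eval Y t a v -> eval X (oracle_subst r t) a v.
Proof.
intros Hr; revert t a v.
apply (eval_nested_ind Y (fun t a v => eval X (oracle_subst r t) a v)
         (fun gs a vs => evals X (map (oracle_subst r) gs) a vs));
  simpl; try (econstructor; eauto; fail).
(* An oracle call reads the head of its argument list with default 0, just as [RProj 0] does, also
   on the empty list. *)
intros a; apply ev_comp with [nth 0 a 0].
- repeat constructor.
- destruct a; apply Hr.
Qed.

Lemma turing_le_trans X Y Z : turing_le X Y -> turing_le Y Z -> turing_le X Z.
Proof.
intros [t Ht] [r Hr]; exists (oracle_subst r t).
intros n; now apply eval_oracle_subst with Y.
Qed.

Lemma turing_le_refl X : turing_le X X.
Proof. exists ROracle; intros n; apply (ev_oracle X [n]). Qed.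

(** * Computable functions of a fixed number of arguments *)

(** A fixed arity lets a term rebuild its argument list from [k] projections, which is how arguments
    are passed on through [RComp]. *)
Definition computable (X : set_nat) (k : nat) (f : list nat -> nat) : Prop :=
  exists t, forall a, length a = k -> eval X t a (f a).

Definition decidable_in (X : set_nat) (k : nat) (p : list nat -> bool) : Prop :=
  computable X k (fun a => if p a then 1 else 0).

Section Computable.

Variable X : set_nat.
Variable k : nat.

Lemma computable_ext f g :
  (forall a, length a = k -> f a = g a) -> computable X k f -> computable X k g.
Proof. intros H [t Ht]; exists t; intros a Ha; rewrite <- H; auto. Qed.

Lemma computable_proj i : computable X k (fun a => nth i a 0).
Proof. exists (RProj i); constructor. Qed.

Lemma computable_succ f : computable X k f -> computable X k (fun a => S (f a)).
Proof.
intros [t Ht]; exists (RComp RSucc [t]); intros a Ha.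
apply ev_comp with [f a]; [repeat constructor; auto|].
apply (ev_succ X [f a]).
Qed.

Lemma computable_const c : computable X k (fun _ => c).
Proof.
induction c as [|c IH]; [exists RZero; constructor|now apply computable_succ].
Qed.

Lemma decidable_turing_le Y f :
  turing_le Y X -> computable X k f -> decidable_in X k (fun a => Y (f a)).
Proof.
intros [r Hr] [t Ht]; exists (RComp r [t]); intros a Ha.
apply ev_comp with [f a]; [repeat constructor; auto|apply Hr].
Qed.

Lemma evals_proj_skipn a j :
  evals X (map RProj (seq j (length a - j))) a (skipn j a).
Proof.
remember (length a - j) as d eqn:Hd; revert j Hd.
induction d as [|d IH]; intros j Hd; simpl.
- rewrite skipn_all2 by lia; constructor.
- replace (skipn j a) with (nth j a 0 :: skipn (S j) a).
  + repeat constructor; apply IH; lia.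
  + assert (Hj : j < length a) by lia; clear - Hj; revert j Hj.
    induction a as [|x a IHa]; intros [|j] Hj; simpl in *; try lia; auto.
    apply IHa; lia.
Qed.

Lemma evals_proj a : length a = k -> evals X (map RProj (seq 0 k)) a a.
Proof.
intros Ha; pose proof (evals_proj_skipn a 0) as H.
now rewrite Nat.sub_0_r, Ha in H.
Qed.

Lemma computable_rec n g h :
  computable X k n -> computable X k g -> computable X (S (S k)) h ->
  computable X k
    (fun a => nat_rect (fun _ => nat) (g a) (fun i u => h (i :: u :: a)) (n a)).
Proof.
intros [tn Hn] [tg Hg] [th Hh].
exists (RComp (RPrec tg th) (tn :: map RProj (seq 0 k))); intros a Ha.
apply ev_comp with (n a :: a); [constructor; auto using evals_proj|].
induction (n a) as [|m IH]; simpl; [constructor; auto|].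
econstructor; [exact IH|]; apply Hh; simpl; lia.
Qed.

Lemma computable_push c f : computable X k c -> computable X (S k) f ->
  computable X k (fun a => f (c a :: a)).
Proof.
intros [tc Hc] [tf Hf].
exists (RComp tf (tc :: map RProj (seq 0 k))); intros a Ha.
apply ev_comp with (c a :: a); [constructor; auto using evals_proj|].
apply Hf; simpl; lia.
Qed.

End Computable.

(** A primitive recursion whose counter is the truth value of [p]: the base is the else branch, and
    a single step gives the other, computed from the arguments behind counter and accumulator. *)
Lemma computable_if X k p f g :
  decidable_in X k p -> computable X k f -> computable X k g ->
  computable X k (fun a => if p a then f a else g a).
Proof.
intros Hp Hf [tg Hg].
assert (H : computable X (S (S k)) (fun a => f (skipn 2 a))).
{ destruct Hf as [tf Hf]; exists (RComp tf (map RProj (seq 2 k))); intros a Ha.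
  apply ev_comp with (skipn 2 a).
  - pose proof (evals_proj_skipn X a 2) as H.
    now replace (length a - 2) with k in H by lia.
  - apply Hf; rewrite length_skipn; lia. }
apply (computable_ext X k _ _) with
  (2 := computable_rec X k _ _ _ Hp (ex_intro _ tg Hg) H).
now intros a Ha; destruct (p a).
Qed.

Lemma decidable_if X k p q r :
  decidable_in X k p -> decidable_in X k q -> decidable_in X k r ->
  decidable_in X k (fun a => if p a then q a else r a).
Proof.
intros Hp Hq Hr; eapply computable_ext; [|exact (computable_if _ _ _ _ _ Hp Hq Hr)].
now intros a _; simpl; destruct (p a).
Qed.

Lemma decidable_const X k b : decidable_in X k (fun _ => b).
Proof. exact (computable_const X k (if b then 1 else 0)). Qed.

Lemma decidable_negb X k p : decidable_in X k p -> decidable_in X k (fun a => negb (p a)).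
Proof. intros H; apply (decidable_if X k p _ _ H); apply decidable_const. Qed.

Lemma decidable_nonzero X k f :
  computable X k f -> decidable_in X k (fun a => negb (f a =? 0)).
Proof.
intros Hf; eapply computable_ext;
  [|apply (computable_rec X k f (fun _ => 0) (fun _ => 1) Hf); apply computable_const].
now intros a _; simpl; destruct (f a).
Qed.

Lemma decidable_odd X k f :
  computable X k f -> decidable_in X k (fun a => Nat.odd (f a)).
Proof.
intros Hf; eapply computable_ext;
  [|apply (computable_rec X k f (fun _ => 0)
             (fun a => if negb (negb (nth 1 a 0 =? 0)) then 1 else 0) Hf)].
- intros a _; simpl; induction (f a) as [|n IH]; auto.
  rewrite Nat.odd_succ, <- Nat.negb_odd; cbn [nat_rect]; rewrite IH.
  now destruct (Nat.odd n).
- apply computable_const.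
- apply decidable_negb, decidable_nonzero, computable_proj.
Qed.

Lemma div2_succ n : Nat.div2 (S n) = if Nat.odd n then S (Nat.div2 n) else Nat.div2 n.
Proof.
pose proof (Nat.div2_odd n); pose proof (Nat.div2_odd (S n)).
rewrite Nat.odd_succ, <- Nat.negb_odd in *.
destruct (Nat.odd n); cbn [Nat.b2n negb] in *; lia.
Qed.

Lemma computable_div2 X k f :
  computable X k f -> computable X k (fun a => Nat.div2 (f a)).
Proof.
intros Hf; eapply computable_ext;
  [|apply (computable_rec X k f (fun _ => 0)
             (fun a => if Nat.odd (nth 0 a 0) then S (nth 1 a 0) else nth 1 a 0) Hf)].
- intros a _; cbv beta; induction (f a) as [|n IH]; auto.
  cbn [nat_rect]; rewrite div2_succ; simpl nth in *; now rewrite IH.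
- apply computable_const.
- apply computable_if; [apply decidable_odd|apply computable_succ|];
    apply computable_proj.
Qed.

Lemma computable_pred X k f :
  computable X k f -> computable X k (fun a => pred (f a)).
Proof.
intros Hf; eapply computable_ext;
  [|apply (computable_rec X k f (fun _ => 0) (fun a => nth 0 a 0) Hf)].
- now intros a _; cbv beta; destruct (f a).
- apply computable_const.
- apply computable_proj.
Qed.

Lemma computable_add X k f g :
  computable X k f -> computable X k g -> computable X k (fun a => f a + g a).
Proof.
intros Hf Hg; eapply computable_ext;
  [|apply (computable_rec X k f g (fun a => S (nth 1 a 0)) Hf Hg)].
- intros a _; cbv beta; induction (f a) as [|n IH]; simpl in *; auto.
- apply computable_succ, computable_proj.
Qed.

Lemma computable_iter X k F f g :
  (forall j h, computable X j h -> computable X j (fun a => F (h a))) ->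
  computable X k f -> computable X k g ->
  computable X k (fun a => Nat.iter (f a) F (g a)).
Proof.
intros HF Hf Hg; eapply computable_ext;
  [|apply (computable_rec X k f g (fun a => F (nth 1 a 0)) Hf Hg)].
- intros a _; cbv beta; induction (f a) as [|n IH]; simpl in *; congruence.
- apply HF, computable_proj.
Qed.

(** Recursion on the bound: entry 1 records whether all earlier instances held, and entry 0 is the
    instance being tested. *)
Lemma decidable_forallb X k p f :
  decidable_in X (S k) p -> computable X k f ->
  decidable_in X k (fun a => forallb (fun c => p (c :: a)) (seq 0 (f a))).
Proof.
intros Hp Hf.
assert (H : computable X (S (S k)) (fun a => 
   if (if negb (nth 1 a 0 =? 0) then p (nth 0 a 0 :: skipn 2 a) else false)
   then 1 else 0)).
{ apply decidable_if; [apply decidable_nonzero, computable_proj| |apply decidable_const].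
  destruct Hp as [t Ht].
  exists (RComp t (RProj 0 :: map RProj (seq 2 k))); intros a Ha.
  apply ev_comp with (nth 0 a 0 :: skipn 2 a).
  - constructor; [constructor|].
    pose proof (evals_proj_skipn X a 2) as H.
    now replace (length a - 2) with k in H by lia.
  - apply Ht; cbn [length]; rewrite length_skipn; lia. }
eapply computable_ext; [|apply (computable_rec X k f _ _ Hf (computable_const X k 1) H)].
intros a _; cbv beta; induction (f a) as [|n IH]; auto.
rewrite seq_S, forallb_app; cbn [nat_rect]; rewrite IH; simpl.
destruct (forallb _ _), (p _); reflexivity.
Qed.

(** * Turing reductions and joins *)

Lemma turing_le_dec X p : decidable_in X 1 (fun a => p (nth 0 a 0)) -> turing_le p X.
Proof. intros [t Ht]; exists t; intros n; now apply (Ht [n]). Qed.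

Lemma tjoin_le X Y Z : turing_le X Z -> turing_le Y Z -> turing_le (tjoin X Y) Z.
Proof.
intros HX HY; apply turing_le_dec; unfold tjoin.
apply decidable_if.
- eapply computable_ext;
    [|apply decidable_negb, decidable_odd, (computable_proj _ _ 0)].
  intros a _; simpl; now rewrite Nat.negb_odd.
- apply (decidable_turing_le Z 1 X); auto; apply computable_div2, computable_proj.
- apply (decidable_turing_le Z 1 Y); auto; apply computable_div2, computable_proj.
Qed.

Lemma tjoin_even X Y n : tjoin X Y (n + n) = X n.
Proof.
unfold tjoin; replace (n + n) with (2 * n) by lia.
now rewrite Nat.even_even, Nat.div2_double.
Qed.

Lemma tjoin_odd X Y n : tjoin X Y (S (n + n)) = Y n.
Proof.
unfold tjoin; replace (n + n) with (2 * n) by lia.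
rewrite Nat.div2_succ_double, Nat.even_succ, Nat.odd_even; auto.
Qed.

Lemma turing_le_tjoin_l X Y : turing_le X (tjoin X Y).
Proof.
apply turing_le_dec; eapply computable_ext;
  [|apply (decidable_turing_le _ 1 _ (fun a => nth 0 a 0 + nth 0 a 0)
             (turing_le_refl _)), computable_add; apply computable_proj].
intros a _; simpl; now rewrite tjoin_even.
Qed.

Lemma turing_le_tjoin_r X Y : turing_le Y (tjoin X Y).
Proof.
apply turing_le_dec; eapply computable_ext;
  [|apply (decidable_turing_le _ 1 _ (fun a => S (nth 0 a 0 + nth 0 a 0))
             (turing_le_refl _)), computable_succ, computable_add; apply computable_proj].
intros a _; simpl; now rewrite tjoin_odd.
Qed.

(** * Binary strings and trees *)

(** [code] is bijective base-2 notation with digits 1 and 2, the first bit being least significant,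
    so parity reveals the first bit. *)
Lemma code_inj s t : code s = code t -> s = t.
Proof.
revert t; induction s as [|b s IH]; intros [|c t]; cbn [code]; intros H; auto.
- destruct c; lia.
- destruct b; lia.
- assert (b = c) by (destruct b, c; auto; lia); subst; f_equal; apply IH; lia.
Qed.

Lemma code_surj c : exists s, code s = c.
Proof.
induction c as [c IH] using lt_wf_ind.
destruct c as [|c]; [now exists []|].
destruct (IH (Nat.div2 c)) as [s Hs].
{ pose proof (Nat.div2_odd c); destruct (Nat.odd c); cbn [Nat.b2n] in *; lia. }
exists (Nat.odd c :: s); cbn [code]; rewrite Hs.
pose proof (Nat.div2_odd c); destruct (Nat.odd c); cbn [Nat.b2n] in *; lia.
Qed.

Lemma length_le_code s : length s <= code s.
Proof. induction s as [|b s IH]; cbn [code length]; [lia|destruct b; lia]. Qed.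

Definition code_tail (c : nat) : nat := Nat.div2 (pred c).

Lemma code_tail_cons b s : code_tail (code (b :: s)) = code s.
Proof.
unfold code_tail; cbn [code].
destruct b.
- replace (pred (2 * code s + 2)) with (S (2 * code s)) by lia.
  apply Nat.div2_succ_double.
- replace (pred (2 * code s + 1)) with (2 * code s) by lia.
  apply Nat.div2_double.
Qed.

Lemma odd_code_cons b s : Nat.odd (code (b :: s)) = negb b.
Proof.
cbn [code]; rewrite Nat.odd_add, Nat.odd_mul; now destruct b.
Qed.

Lemma iter_code_tail n s : Nat.iter n code_tail (code s) = code (skipn n s).
Proof.
revert s; induction n as [|n IH]; intros s; [now destruct s|].
rewrite Nat.iter_succ_r; destruct s as [|b s].
- change (code_tail (code [])) with (code []); rewrite IH; now rewrite skipn_nil.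
- now rewrite code_tail_cons, IH.
Qed.

Lemma odd_iter_code_tail n s :
  n < length s -> Nat.odd (Nat.iter n code_tail (code s)) = negb (nth n s false).
Proof.
rewrite iter_code_tail; revert s; induction n as [|n IH]; intros [|b s] H;
  simpl length in H; try lia.
- apply odd_code_cons.
- apply IH; lia.
Qed.

Lemma iter_code_tail_eq0 n s :
  Nat.iter n code_tail (code s) = 0 <-> length s <= n.
Proof.
rewrite iter_code_tail; split.
- intros H; apply (code_inj _ []) in H; pose proof (length_skipn n s).
  rewrite H in *; simpl in *; lia.
- intros H; now rewrite skipn_all2.
Qed.

(** This is [2^(n+1) - 1], the number of strings of length at most [n]; their codes are exactly the
    numbers below it. *)
Definition code_bound (n : nat) : nat := Nat.iter n (fun c => S (c + c)) 1.

Lemma code_lt_bound s : code s < code_bound (length s).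
Proof.
unfold code_bound; induction s as [|b s IH]; cbn [code length]; [simpl; lia|].
rewrite Nat.iter_succ; destruct b; lia.
Qed.

Fixpoint code_extends (s : list bool) (c : nat) : bool :=
  match s with
  | [] => true
  | b :: s => if negb (c =? 0) then
      if eqb (Nat.odd c) (negb b) then code_extends s (code_tail c) else false
      else false
  end.

Lemma prefix_cons b s c t : prefix (b :: s) (c :: t) <-> b = c /\ prefix s t.
Proof.
split.
- intros [r Hr]; injection Hr as -> ->; split; [|exists r]; auto.
- intros [-> [r ->]]; now exists r.
Qed.

Lemma code_extends_spec s t : code_extends s (code t) = true <-> prefix s t.
Proof.
revert t; induction s as [|b s IH]; intros t; simpl.
- split; auto; intros _; now exists t.
- destruct t as [|c t].
  { split; [discriminate|intros [r Hr]; discriminate]. }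
  rewrite odd_code_cons, code_tail_cons, prefix_cons, <- IH.
  replace (code (c :: t) =? 0) with false
    by (symmetry; apply Nat.eqb_neq; cbn [code]; destruct c; lia).
  destruct b, c; simpl; intuition discriminate.
Qed.

Lemma prefix_trans s t u : prefix s t -> prefix t u -> prefix s u.
Proof. intros [r ->] [r' ->]; exists (r ++ r'); now rewrite app_assoc. Qed.

Lemma prefix_length s t : prefix s t -> length s <= length t.
Proof. intros [r ->]; rewrite length_app; lia. Qed.

Lemma prefix_nth s t n d : prefix s t -> n < length s -> nth n s d = nth n t d.
Proof. intros [r ->] Hn; now rewrite app_nth1. Qed.

Lemma prefix_firstn n s : prefix (firstn n s) s.
Proof. exists (skipn n s); now rewrite firstn_skipn. Qed.

Lemma prefix_firstn_of s t n : prefix s t -> length s <= n -> prefix s (firstn n t).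
Proof.
intros [r ->] Hn; rewrite firstn_app, firstn_all2 by lia.
now exists (firstn (n - length s) r).
Qed.

Lemma prefix_init_seg P n m : n <= m -> prefix (init_seg P n) (init_seg P m).
Proof.
intros H; unfold init_seg; replace m with (n + (m - n)) by lia.
rewrite seq_app, map_app; eexists; reflexivity.
Qed.

Lemma length_init_seg P n : length (init_seg P n) = n.
Proof. unfold init_seg; now rewrite length_map, length_seq. Qed.

Lemma nth_init_seg P n m : m < n -> nth m (init_seg P n) false = P m.
Proof.
intros H; rewrite nth_indep with (d' := P 0) by (now rewrite length_init_seg).
unfold init_seg; rewrite map_nth, seq_nth; auto.
Qed.

Fixpoint strings (n : nat) : list (list bool) :=
  match n with
  | 0 => [[]]
  | S n => map (cons false) (strings n) ++ map (cons true) (strings n)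
  end.

Lemma in_strings n s : In s (strings n) <-> length s = n.
Proof.
revert s; induction n as [|n IH]; intros s; simpl.
- destruct s; simpl; intuition discriminate.
- rewrite in_app_iff, !in_map_iff; split.
  + intros [[t [<- Ht]]|[t [<- Ht]]]; simpl; f_equal; now apply IH.
  + destruct s as [|b s]; intros H; [discriminate|injection H as H].
    apply IH in H; destruct b; [right|left]; eauto.
Qed.

(** Only finitely many strings are shorter than a given length. *)
Lemma infinite_strs_unbounded P :
  infinite_strs P <-> forall n, exists t, P t /\ n <= length t.
Proof.
split.
- intros H n; apply NNPP; intros Hn; apply H.
  exists (flat_map strings (seq 0 n)); intros t Ht.
  apply in_flat_map; exists (length t); rewrite in_strings, in_seq; split; auto.
  destruct (le_lt_dec n (length t)); [exfalso; eauto|lia].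
- intros H [l Hl].
  assert (Hb : exists n, forall t, In t l -> length t < n).
  { clear; induction l as [|s l [n IH]]; [exists 0; easy|].
    exists (max n (S (length s))); intros t [<-|Ht]; [lia|].
    apply IH in Ht; lia. }
  destruct Hb as [n Hn]; destruct (H n) as [t [Ht Hle]].
  specialize (Hn t (Hl t Ht)); lia.
Qed.

Lemma Ext_prefix T s t : is_tree T -> prefix s t -> Ext T t -> Ext T s.
Proof.
intros HT Hst [Ht Hinf]; split; [now apply (HT s t)|].
rewrite infinite_strs_unbounded in *; intros n.
destruct (Hinf n) as [u [[Hu Htu] Hn]]; exists u; eauto using prefix_trans.
Qed.

Lemma Ext_unbounded T s :
  is_tree T ->
  (Ext T s <-> forall n, exists t, T t /\ prefix s t /\ n <= length t).
Proof.
intros HT; unfold Ext; rewrite infinite_strs_unbounded; split.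
- intros [_ H] n; destruct (H n) as [t [[]]]; eauto.
- intros H; split.
  + destruct (H 0) as [t [Ht [Hp _]]]; now apply (HT s t).
  + intros n; destruct (H n) as [t [? []]]; eauto.
Qed.

(* Pigeonhole over the finitely many strings of a given length. *)
Lemma Ext_of_length T n (A : list bool -> Prop) :
  is_tree T ->
  (forall l, exists t, T t /\ A (firstn n t) /\ l <= length t) ->
  exists r, length r = n /\ A r /\ Ext T r.
Proof.
intros HT H; apply NNPP; intros Hno.
(* If no suitable [r] is extendible, the tree above each of them has bounded height, and finitely
   many bounds have a maximum. *)
assert (Hb : forall L, (forall r, In r L -> length r = n) -> exists l,
  forall r, In r L -> A r -> forall t, T t -> prefix r t -> length t < l).
{ induction L as [|r L IH]; intros HL; [exists 0; easy|].
  destruct IH as [l Hl]; [intros; apply HL; now right|].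
  destruct (classic (A r)) as [HA|HA].
  - assert (Hr : ~ Ext T r) by (intros E; apply Hno; exists r; split; [apply HL; now left|auto]).
    rewrite Ext_unbounded in Hr by auto.
    apply not_all_ex_not in Hr as [l' Hl'].
    exists (max l l'); intros r' [<-|Hr'] HA' t Ht Hp.
    + destruct (le_lt_dec l' (length t)); [exfalso; eauto|lia].
    + specialize (Hl r' Hr' HA' t Ht Hp); lia.
  - exists l; intros r' [<-|Hr'] HA' t Ht Hp; [easy|].
    now apply (Hl r'). }
destruct (Hb (strings n)) as [l Hl]; [intros r; apply in_strings|].
destruct (H (max n l)) as [t [Ht [HA Hle]]].
specialize (Hl (firstn n t)).
rewrite in_strings, length_firstn in Hl.
specialize (Hl ltac:(lia) HA t Ht (prefix_firstn n t)); lia.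
Qed.

Lemma common_prefix u v :
  length u = length v -> u <> v ->
  exists p b, prefix (p ++ [b]) u /\ prefix (p ++ [negb b]) v.
Proof.
revert v; induction u as [|b u IH]; intros [|c v] Hl Hne; try easy.
destruct (bool_dec b c) as [->|Hbc].
- destruct (IH v) as [p [d [Hu Hv]]]; [now injection Hl|congruence|].
  exists (c :: p), d; simpl; rewrite !prefix_cons; auto.
- exists [], b; simpl; rewrite !prefix_cons.
  split; split; auto; try (eexists; reflexivity).
  destruct b, c; easy.
Qed.

(** [u] and [v] part at a node with both children extendible; as both extend [s], they cannot part
    before [s] ends. *)
Lemma Br_between T s u v :
  is_tree T -> prefix s u -> prefix s v -> length u = length v -> u <> v ->
  Ext T u -> Ext T v -> exists p, Br T p /\ length s <= length p.
Proof.
intros HT Hsu Hsv Hl Hne Hu Hv.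
destruct (common_prefix u v Hl Hne) as [p [b [Hpu Hpv]]].
exists p; split.
- assert (Hp : Ext T p).
  { apply (Ext_prefix T p u); auto; apply prefix_trans with (p ++ [b]); auto.
    now exists [b]. }
  apply (Ext_prefix T _ _ HT Hpu) in Hu; apply (Ext_prefix T _ _ HT Hpv) in Hv.
  split; [apply Hp|]; destruct b; auto.
- destruct (le_lt_dec (length s) (length p)) as [|Hlt]; auto; exfalso.
  assert (E1 : nth (length p) s false = b).
  { rewrite (prefix_nth s u) by auto.
    rewrite <- (prefix_nth (p ++ [b]) u) by (rewrite ?length_app; simpl; auto; lia).
    now rewrite app_nth2, Nat.sub_diag by lia. }
  assert (E2 : nth (length p) s false = negb b).
  { rewrite (prefix_nth s v) by auto.
    rewrite <- (prefix_nth (p ++ [negb b]) v) by (rewrite ?length_app; simpl; auto; lia).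
    now rewrite app_nth2, Nat.sub_diag by lia. }
  rewrite E1 in E2; now destruct b.
Qed.

(** * Isolated paths *)

Section IsolatedPath.

Variable X : set_nat.
Let T := tree_of X.
Hypothesis HT : is_tree T.
Variable s : list bool.
Hypothesis Hs : Ext T s.
Hypothesis Hbr : forall p, Br T p -> length p < length s.

(** The level inspected lies beyond both [n] and [length s], and [d] is left to a search. A single
    finite level is involved, so the condition is decidable from [X]. *)
Definition forces_bit (v : bool) (n d : nat) : Prop :=
  forall t, T t -> prefix s t -> length t = S (d + (n + length s)) ->
  nth n t false = v.

Lemma forces_bit_longer v n d t :
  forces_bit v n d -> T t -> prefix s t -> S (d + (n + length s)) <= length t ->
  nth n t false = v.
Proof.
intros Hv Ht Hp Hl.
rewrite <- (Hv (firstn (S (d + (n + length s))) t)).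
- symmetry; apply prefix_nth; [apply prefix_firstn|].
  rewrite length_firstn; lia.
- apply (HT _ t Ht), prefix_firstn.
- apply prefix_firstn_of; auto; lia.
- rewrite length_firstn; lia.
Qed.

Lemma forces_bit_unique v w n d e : forces_bit v n d -> forces_bit w n e -> v = w.
Proof.
intros Hv Hw.
destruct (proj1 (Ext_unbounded T s HT) Hs (S (max d e + (n + length s))))
  as [t [Ht [Hp Hl]]].
rewrite <- (forces_bit_longer v n d t), <- (forces_bit_longer w n e t); auto; lia.
Qed.

(** If neither value were forced, both would occur at position [n] on arbitrarily long extensions of
    [s]. Pigeonhole then gives two extendible nodes differing there, hence a branching node no
    shorter than [s], against [Hbr]. *)
Lemma forces_bit_exists n : exists v d, forces_bit v n d.
Proof.
apply NNPP; intros Hno.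
assert (Hext : forall v, exists r, length r = S (n + length s) /\
  (prefix s r /\ nth n r false = v) /\ Ext T r).
{ intros v; apply Ext_of_length; auto; intros l.
  apply NNPP; intros Hl; apply Hno; exists (negb v), l.
  intros t Ht Hp Hlen; apply NNPP; intros Hn; apply Hl.
  exists t; repeat split; auto; [apply prefix_firstn_of; auto; lia| |lia].
  rewrite (prefix_nth _ t) by
    (try apply prefix_firstn; rewrite length_firstn; lia).
  destruct v, (nth n t false); simpl in *; congruence. }
destruct (Hext false) as [r0 [L0 [[P0 N0] E0]]].
destruct (Hext true) as [r1 [L1 [[P1 N1] E1]]].
destruct (Br_between T s r0 r1) as [p [Hp Hle]]; auto; [congruence..|].
specialize (Hbr p Hp); lia.
Qed.

(** The bound admits lengths up to that of the inspected level, and the nonzero iterate excludes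
    shorter strings. Parity is compared with [negb v] because the odd digit 1 stands for [false]. *)
Definition code_forces_bit (v : bool) (n d : nat) : bool :=
  forallb (fun c =>
    if (if X c then
          if code_extends s c then
            negb (Nat.iter (d + (n + length s)) code_tail c =? 0)
          else false
        else false)
    then eqb (Nat.odd (Nat.iter n code_tail c)) (negb v) else true)
    (seq 0 (code_bound (S (d + (n + length s))))).

Lemma code_bound_length c n : c < code_bound n -> exists t, code t = c /\ length t <= n.
Proof.
revert c; induction n as [|n IH]; intros c Hc.
- exists []; unfold code_bound in Hc; simpl in *; lia.
- destruct (code_surj c) as [[|b t] <-]; [exists []; simpl; split; auto; lia|].
  destruct (IH (code t)) as [t' [E Ht']].
  + unfold code_bound in *; rewrite Nat.iter_succ in Hc; cbn [code] in Hc.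
    destruct b; lia.
  + apply code_inj in E; subst t'; exists (b :: t); simpl; split; auto; lia.
Qed.

Lemma code_forces_bit_spec v n d : code_forces_bit v n d = true <-> forces_bit v n d.
Proof.
unfold code_forces_bit; rewrite forallb_forall; split.
- intros H t Ht Hp Hl; specialize (H (code t)).
  rewrite in_seq, <- Hl in H; specialize (H (conj (Nat.le_0_l _) (code_lt_bound t))).
  change (X (code t) = true) in Ht; rewrite Ht in H.
  rewrite (proj2 (code_extends_spec s t) Hp) in H.
  rewrite (proj2 (Nat.eqb_neq _ 0)) in H by (rewrite iter_code_tail_eq0; lia).
  simpl in H; rewrite odd_iter_code_tail in H by lia.
  destruct (nth n t false), v; easy.
- intros H c Hc; apply in_seq in Hc.
  destruct (code_bound_length c _ (proj2 Hc)) as [t [<- Ht]].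
  destruct (X (code t)) eqn:HX; auto.
  destruct (code_extends s (code t)) eqn:He; auto.
  destruct (negb (Nat.iter _ _ _ =? 0)) eqn:Hn; auto.
  apply negb_true_iff, Nat.eqb_neq in Hn; rewrite iter_code_tail_eq0 in Hn.
  rewrite odd_iter_code_tail by lia; rewrite (H t); [now destruct v|auto| |lia].
  now apply code_extends_spec.
Qed.

Lemma computable_code_tail k f :
  computable X k f -> computable X k (fun a => code_tail (f a)).
Proof. intros Hf; apply computable_div2, computable_pred, Hf. Qed.

Lemma decidable_eqb_odd k f v :
  computable X k f -> decidable_in X k (fun a => eqb (Nat.odd (f a)) v).
Proof.
intros Hf; destruct v.
- eapply computable_ext; [|apply (decidable_odd X k f Hf)].
  now intros a _; simpl; destruct (Nat.odd (f a)).
- eapply computable_ext; [|apply decidable_negb, (decidable_odd X k f Hf)].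
  now intros a _; simpl; destruct (Nat.odd (f a)).
Qed.

Lemma decidable_code_extends u k f :
  computable X k f -> decidable_in X k (fun a => code_extends u (f a)).
Proof.
revert f; induction u as [|b u IH]; intros f Hf; [exact (decidable_const X k true)|].
apply decidable_if; [now apply decidable_nonzero| |apply decidable_const].
apply decidable_if; [now apply decidable_eqb_odd| |apply decidable_const].
now apply (IH (fun a => code_tail (f a))), computable_code_tail.
Qed.

Lemma decidable_code_forces_bit v :
  decidable_in X 2 (fun a => code_forces_bit v (nth 1 a 0) (nth 0 a 0)).
Proof.
set (len := fun i a => nth i a 0 + (nth (S i) a 0 + length s)).
assert (Hlen : forall k i, computable X k (len i)).
{ intros k i; repeat apply computable_add; auto using computable_proj, computable_const. }
apply (decidable_forallb X 2 (fun a =>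
    if (if X (nth 0 a 0) then
          if code_extends s (nth 0 a 0) then
            negb (Nat.iter (len 1 a) code_tail (nth 0 a 0) =? 0)
          else false
        else false)
    then eqb (Nat.odd (Nat.iter (nth 2 a 0) code_tail (nth 0 a 0))) (negb v) else true)
  (fun a => code_bound (S (len 0 a)))).
- assert (Hit : forall f, computable X 3 f ->
    computable X 3 (fun a => Nat.iter (f a) code_tail (nth 0 a 0))).
  { intros f Hf; apply computable_iter; auto using computable_proj.
    intros; now apply computable_code_tail. }
  apply decidable_if; [apply decidable_if; [|apply decidable_if|]| |];
    try apply decidable_const.
  + apply decidable_turing_le; [apply turing_le_refl|apply computable_proj].
  + apply decidable_code_extends, computable_proj.
  + apply decidable_nonzero, Hit, Hlen.
  + apply decidable_eqb_odd, Hit, computable_proj.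
- apply computable_iter; [| |apply computable_const].
  + intros j h Hh; now apply computable_succ, computable_add.
  + apply computable_succ, Hlen.
Qed.

Lemma computable_search k f :
  computable X (S k) f -> (forall a, length a = k -> exists n, f (n :: a) = 0) ->
  exists g, computable X k g /\ forall a, length a = k -> f (g a :: a) = 0.
Proof.
intros [t Ht] Hex.
(* [ev_mu] demands positive values below its result, so the least zero is chosen; for lists of the
   wrong length any number will do. *)
assert (Hmin : forall a, exists n, length a = k ->
  f (n :: a) = 0 /\ forall m, m < n -> f (m :: a) <> 0).
{ intros a; destruct (Nat.eq_dec (length a) k) as [Ha|]; [|now exists 0].
  destruct (Hex a Ha) as [n Hn]; revert Hn.
  induction n as [n IH] using lt_wf_ind; intros Hn.
  destruct (classic (exists m, m < n /\ f (m :: a) = 0)) as [[m [Hm Hf]]|Hno].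
  - now apply (IH m).
  - exists n; intros _; split; auto; intros m Hm Hf; apply Hno; eauto. }
exists (fun a => proj1_sig (constructive_indefinite_description _ (Hmin a))).
split; [exists (RMu t)|]; intros a Ha;
  destruct (constructive_indefinite_description _ (Hmin a)) as [n Hn]; simpl;
  destruct (Hn Ha) as [H0 Hlow]; auto.
constructor.
- rewrite <- H0; apply Ht; simpl; lia.
- intros m Hm; exists (pred (f (m :: a))); specialize (Hlow m Hm).
  replace (S (pred (f (m :: a)))) with (f (m :: a)) by lia.
  apply Ht; simpl; lia.
Qed.

(** Bit [n] is computed by searching for a [d] at which one of the values is forced; uniqueness
    makes the answer independent of the [d] found. *)
Lemma isolated_path : exists P, turing_le P X /\ forall n, T (init_seg P n).
Proof.
assert (HP : exists P : nat -> bool, forall n, exists d, forces_bit (P n) n d).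
{ exists (fun n => proj1_sig (constructive_indefinite_description _ (forces_bit_exists n))).
  intros n; now destruct (constructive_indefinite_description _ (forces_bit_exists n)). }
destruct HP as [P HP]; exists P; split.
- destruct (computable_search 1 (fun a =>
    if (if code_forces_bit true (nth 1 a 0) (nth 0 a 0) then false else
        if code_forces_bit false (nth 1 a 0) (nth 0 a 0) then false else true)
    then 1 else 0)) as [g [Hg Hg0]].
  + apply decidable_if; [|apply decidable_const|apply decidable_if];
      try apply decidable_const; apply decidable_code_forces_bit.
  + intros a _; simpl; destruct (HP (nth 0 a 0)) as [d Hd]; exists d.
    destruct (P (nth 0 a 0)); apply code_forces_bit_spec in Hd; rewrite Hd; auto.
    now destruct (code_forces_bit true _ _).
  + apply turing_le_dec.
    eapply computable_ext;
      [|apply (computable_push X 1 g _ Hg (decidable_code_forces_bit true))].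
    intros a Ha; simpl; specialize (Hg0 a Ha); simpl in Hg0.
    set (n := nth 0 a 0) in *; destruct (HP n) as [d Hd].
    destruct (code_forces_bit true n (g a)) eqn:E1.
    * apply code_forces_bit_spec in E1; now rewrite (forces_bit_unique _ _ _ _ _ Hd E1).
    * destruct (code_forces_bit false n (g a)) eqn:E0; [|discriminate].
      apply code_forces_bit_spec in E0; now rewrite (forces_bit_unique _ _ _ _ _ Hd E0).
- intros n.
  (* One length [l] forces the first [n] bits simultaneously, and the extendible [s] has an
     extension in [T] at least that long. *)
  destruct (uniform_bound (fun m l => forall t, T t -> prefix s t -> l <= length t ->
    nth m t false = P m) n) as [l Hl].
  + intros m u u' Hu H t Ht Hp Hle; apply H; auto; lia.
  + intros m _; destruct (HP m) as [d Hd]; exists (S (d + (m + length s))).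
    intros t Ht Hp Hle; now apply forces_bit_longer with d.
  + destruct (proj1 (Ext_unbounded T s HT) Hs (max l n)) as [t [Ht [Hp Hle]]].
    apply (HT _ t Ht).
    replace (init_seg P n) with (firstn n t); [apply prefix_firstn|].
    apply (nth_ext _ _ false false).
    * rewrite length_firstn, length_init_seg; lia.
    * intros m Hm; rewrite length_firstn in Hm.
      rewrite nth_init_seg, <- (Hl m) with (t := t) by (auto; lia).
      apply prefix_nth; [apply prefix_firstn|rewrite length_firstn; lia].
Qed.

End IsolatedPath.

(** If branching nodes are shorter than some [B], nothing branches above an extendible node of
    length [B], and the path through it is isolated. Otherwise a longer branching node can always be
    added. *)
Lemma path_or_unbounded_branching X :
  infinite_tree (tree_of X) ->
  (exists P, turing_le P X /\ forall n, tree_of X (init_seg P n)) \/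
  (forall n, exists m, br_lengths_at_least (tree_of X) m n).
Proof.
intros [HT Hinf].
destruct (classic (exists B, forall p, Br (tree_of X) p -> length p < B)) as [[B HB]|Hno].
- left.
  destruct (Ext_of_length (tree_of X) B (fun _ => True) HT) as [s [Hs [_ Es]]].
  + intros l; apply infinite_strs_unbounded with (n := l) in Hinf as [t [? ?]]; eauto.
  + apply isolated_path with s; auto; now rewrite Hs.
- right; induction n as [|n [m [ls [Hnd [Hlen Hls]]]]].
  + exists 0, []; repeat split; auto; [constructor|easy..].
  + assert (Hp : exists p, Br (tree_of X) p /\ m <= length p).
    { apply NNPP; intros H; apply Hno; exists m; intros p Hp.
      destruct (le_lt_dec m (length p)); auto; exfalso; eauto. }
    destruct Hp as [p [Hp Hm]]; exists (S (length p)), (length p :: ls).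
    split; [|split].
    * constructor; auto; intros Hin; apply Hls in Hin; lia.
    * simpl; lia.
    * intros l [<-|Hl]; [eauto|]; destruct (Hls l Hl); split; auto; lia.
Qed.

Lemma eval_agree X Y t a v :
  (forall c, X c = Y c) -> eval X t a v -> eval Y t a v.
Proof.
intros H He; destruct (eval_use X t a v He) as [u Hu]; apply Hu.
intros c _; apply H.
Qed.

(** * Countability of terms *)

Fixpoint nats_of_code (fuel c : nat) : list nat :=
  match fuel, c with
  | S fuel, S c => let (a, b) := of_nat c in a :: nats_of_code fuel b
  | _, _ => []
  end.

Lemma nats_of_code_surj l : exists c, forall fuel, length l <= fuel -> nats_of_code fuel c = l.
Proof.
induction l as [|a l [c Hc]].
- exists 0; now intros [].
- exists (S (to_nat (a, c))); intros [|fuel] Hf; simpl in Hf; [lia|].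
  cbn [nats_of_code]; rewrite cancel_of_to, Hc; auto; lia.
Qed.

Fixpoint term_of_code (fuel c : nat) : rterm :=
  match fuel with
  | 0 => RZero
  | S fuel =>
      let (tag, r) := of_nat c in
      let (a, b) := of_nat r in
      match tag with
      | 0 => RZero
      | 1 => RSucc
      | 2 => RProj r
      | 3 => ROracle
      | 4 => RComp (term_of_code fuel a) (map (term_of_code fuel) (nats_of_code fuel b))
      | 5 => RPrec (term_of_code fuel a) (term_of_code fuel b)
      | _ => RMu (term_of_code fuel r)
      end
  end.

Section RtermInduction.

Variable P : rterm -> Prop.
Hypothesis Hzero : P RZero.
Hypothesis Hsucc : P RSucc.
Hypothesis Hproj : forall i, P (RProj i).
Hypothesis Horacle : P ROracle.
Hypothesis Hcomp : forall f gs, P f -> Forall P gs -> P (RComp f gs).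
Hypothesis Hprec : forall g h, P g -> P h -> P (RPrec g h).
Hypothesis Hmu : forall f, P f -> P (RMu f).

Fixpoint rterm_nested_ind (t : rterm) : P t :=
  match t with
  | RZero => Hzero
  | RSucc => Hsucc
  | RProj i => Hproj i
  | ROracle => Horacle
  | RComp f gs =>
      Hcomp f gs (rterm_nested_ind f)
        ((fix all gs : Forall P gs :=
            match gs with
            | [] => Forall_nil P
            | g :: gs => Forall_cons g (rterm_nested_ind g) (all gs)
            end) gs)
  | RPrec g h => Hprec g h (rterm_nested_ind g) (rterm_nested_ind h)
  | RMu f => Hmu f (rterm_nested_ind f)
  end.

End RtermInduction.

(** Decoding is stable for all large fuel, so that subterms of different depths can share one
    fuel. *)
Lemma term_of_code_surj t :
  exists c d, forall fuel, d <= fuel -> term_of_code fuel c = t.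
Proof.
induction t as [| |i| |f gs [c [d Hf]] IHgs|g h [c [d Hg]] [c' [d' Hh]]|f [c [d Hf]]]
  using rterm_nested_ind.
1: exists (to_nat (0, 0)), 1.
2: exists (to_nat (1, 0)), 1.
3: exists (to_nat (2, i)), 1.
4: exists (to_nat (3, 0)), 1.
1-4: intros [|fuel] Hfuel; [lia|]; cbn [term_of_code];
  rewrite cancel_of_to; now destruct (of_nat _).
- assert (Hl : exists l d, forall fuel, d <= fuel -> map (term_of_code fuel) l = gs).
  { induction IHgs as [|g gs [cg [dg Hg]] _ [l [dl Hl]]]; [now exists [], 0|].
    exists (cg :: l), (max dg dl); intros fuel Hfuel; simpl.
    rewrite Hg, Hl; auto; lia. }
  destruct Hl as [l [d' Hl]]; destruct (nats_of_code_surj l) as [cl Hcl].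
  exists (to_nat (4, to_nat (c, cl))), (S (max (length l) (max d d'))).
  intros [|fuel] Hfuel; [lia|]; cbn [term_of_code]; rewrite !cancel_of_to.
  rewrite Hf, Hcl, Hl; auto; lia.
- exists (to_nat (5, to_nat (c, c'))), (S (max d d')).
  intros [|fuel] Hfuel; [lia|]; cbn [term_of_code]; rewrite !cancel_of_to.
  rewrite Hg, Hh; auto; lia.
- exists (to_nat (6, c)), (S d).
  intros [|fuel] Hfuel; [lia|]; cbn [term_of_code]; rewrite cancel_of_to.
  destruct (of_nat c); rewrite Hf; auto; lia.
Qed.

Lemma rterm_countable : exists e : nat -> rterm, forall t, exists i, e i = t.
Proof.
exists (fun i => let (d, c) := of_nat i in term_of_code d c); intros t.
destruct (term_of_code_surj t) as [c [d H]].
exists (to_nat (d, c)); rewrite cancel_of_to; auto.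
Qed.

(** * Baire category *)

Definition point := nat -> nat -> nat.

Definition agree (L : nat) (z z' : point) : Prop :=
  forall k n, k < L -> n < L -> z k n = z' k n.

Lemma agree_refl L z : agree L z z.
Proof. easy. Qed.

Lemma agree_trans L L' z z' z'' :
  L <= L' -> agree L z z' -> agree L' z' z'' -> agree L z z''.
Proof. intros HL H H' k n Hk Hn; rewrite H, H'; auto; lia. Qed.

(** [D i L z] says that fixing the square of side [L] of [z] secures requirement [i]. Density meets
    the requirements one by one along growing squares, and monotonicity carries each over to the
    limit. *)
Lemma baire_category (D : nat -> nat -> point -> Prop) :
  (forall i L L' z z', L <= L' -> agree L z z' -> D i L z -> D i L' z') ->
  (forall i L z, exists L' z', L <= L' /\ agree L z z' /\ D i L' z') ->
  exists z, forall i, exists L, D i L z.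
Proof.
intros Hmono Hdense.
assert (Hstep : forall i (p : nat * point), exists q : nat * point,
  fst p < fst q /\ agree (fst p) (snd p) (snd q) /\ D i (fst q) (snd q)).
{ intros i [L z]; destruct (Hdense i L z) as [L' [z' [HL [Hz HD]]]].
  (* The successor makes the side grow strictly, so that every entry is eventually fixed. *)
  exists (S L', z'); simpl; repeat split; auto; [lia|].
  apply Hmono with L' z'; auto using agree_refl. }
set (step i p := proj1_sig (constructive_indefinite_description _ (Hstep i p))).
assert (Hs : forall i p, fst p < fst (step i p) /\
  agree (fst p) (snd p) (snd (step i p)) /\ D i (fst (step i p)) (snd (step i p))).
{ intros i p; exact (proj2_sig (constructive_indefinite_description _ (Hstep i p))). }
clearbody step.
set (s := nat_rect (fun _ => (nat * point)%type) (0, fun _ _ => 0) step).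
assert (Hge : forall i, i <= fst (s i)).
{ induction i as [|i IH]; [lia|].
  change (s (S i)) with (step i (s i)); specialize (Hs i (s i)); lia. }
assert (Hle : forall i j, i <= j ->
  fst (s i) <= fst (s j) /\ agree (fst (s i)) (snd (s i)) (snd (s j))).
{ intros i j Hij; induction Hij as [|j Hij [IHl IHa]]; [split; auto using agree_refl|].
  change (s (S j)) with (step j (s j)).
  destruct (Hs j (s j)) as [Hlt [Ha _]]; split; [lia|].
  now apply agree_trans with (fst (s j)) (snd (s j)). }
(* At stage [S (max k n)] the square already contains this entry, and later stages preserve it. *)
set (z := fun k n => snd (s (S (max k n))) k n).
assert (Hz : forall i, agree (fst (s i)) (snd (s i)) z).
{ intros i k n Hk Hn; unfold z; set (j := S (max k n)).
  assert (Hj : max k n < fst (s j)) by (specialize (Hge j); lia).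
  destruct (le_lt_dec i j).
  - apply (Hle i j); auto.
  - symmetry; apply (Hle j i); lia. }
exists z; intros i; exists (fst (s (S i))).
apply Hmono with (fst (s (S i))) (snd (s (S i))); auto.
apply Hs.
Qed.

Definition update (z : point) (k n v : nat) : point :=
  fun k' n' => if (k' =? k) && (n' =? n) then v else z k' n'.

Lemma update_same z k n v : update z k n v k n = v.
Proof. unfold update; now rewrite !Nat.eqb_refl. Qed.

Lemma update_other z k n v k' n' : k' <> k \/ n' <> n -> update z k n v k' n' = z k' n'.
Proof.
unfold update; intros H.
destruct (Nat.eqb_spec k' k), (Nat.eqb_spec n' n); simpl; auto; lia.
Qed.

Lemma agree_update L z k n v : L <= n -> agree L z (update z k n v).
Proof. intros HL k' n' _ Hn; symmetry; apply update_other; lia. Qed.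

(** * The generic oracles *)

Definition char (P : Prop) : bool :=
  if excluded_middle_informative P then true else false.

Lemma char_true P : char P = true <-> P.
Proof. unfold char; destruct (excluded_middle_informative P); easy. Qed.

Lemma char_iff P Q : (P <-> Q) -> char P = char Q.
Proof.
unfold char; intros H.
destruct (excluded_middle_informative P), (excluded_middle_informative Q); tauto.
Qed.

Lemma pair_inj n m n' m' : pair n m = pair n' m' -> n = n' /\ m = m'.
Proof.
set (tri s := s * (s + 1) / 2).
assert (Htri : forall s, tri (S s) = tri s + S s).
{ intros s; unfold tri.
  replace (S s * (S s + 1)) with (s * (s + 1) + S s * 2) by lia.
  now rewrite Nat.div_add. }
assert (Hlt : forall s s', s < s' -> tri s + S s <= tri s').
{ intros s s' H; induction H; rewrite Htri; lia. }
change (tri (n + m) + m = tri (n' + m') + m' -> n = n' /\ m = m'); intros H.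
destruct (lt_eq_lt_dec (n + m) (n' + m')) as [[Hs|Hs]|Hs].
- specialize (Hlt _ _ Hs); lia.
- rewrite Hs in H; lia.
- specialize (Hlt _ _ Hs); lia.
Qed.

Lemma le_pair n m : n <= pair n m.
Proof.
unfold pair; enough (n + m <= (n + m) * (n + m + 1) / 2 + m) by lia.
set (s := n + m); destruct s as [|s]; [lia|].
enough (S s <= S s * (S s + 1) / 2) by lia.
apply Nat.div_le_lower_bound; nia.
Qed.

Definition graph (f : nat -> nat) : set_nat :=
  fun c => char (exists n, c = pair n (f n)).

Lemma graph_spec f n m : graph f (pair n m) = true <-> f n = m.
Proof.
unfold graph; rewrite char_true; split.
- intros [n' H]; apply pair_inj in H as [-> ->]; auto.
- intros <-; eauto.
Qed.

Lemma graph_agree u f g :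
  (forall n, n < u -> f n = g n) -> agree_below u (graph f) (graph g).
Proof.
intros H c Hc; apply char_iff; split; intros [n ->]; exists n;
  rewrite H; auto; eapply Nat.le_lt_trans; eauto using le_pair.
Qed.

(* [y n = 0] means that [n] is never enumerated; [y n = S w] that it is enumerated
   at stage [w / 2] into the set whose elements must take the value [Nat.odd w].
   A string of length [l] only has to respect what is enumerated before stage [l]. *)
Definition separating (y : nat -> nat) (s : list bool) : Prop :=
  forall n w, n < length s -> y n = S w -> Nat.div2 w < length s ->
  nth n s false = Nat.odd w.

Definition separating_tree (y : nat -> nat) : set_nat :=
  fun c => char (exists s, code s = c /\ separating y s).

Lemma in_separating_tree y s : tree_of (separating_tree y) s <-> separating y s.
Proof.
unfold tree_of, separating_tree; rewrite char_true; split; [|eauto].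
intros [t [Ht H]]; now apply code_inj in Ht; subst.
Qed.

Lemma is_tree_separating y : is_tree (tree_of (separating_tree y)).
Proof.
intros s t; rewrite !in_separating_tree; intros Ht Hp n w Hn Hy Hw.
pose proof (prefix_length s t Hp).
rewrite (prefix_nth s t) by auto; apply Ht; auto; lia.
Qed.

Definition separator (y : nat -> nat) : set_nat :=
  fun n => match y n with 0 => false | S w => Nat.odd w end.

(** The separator respects every enumeration whatever its stage, so its initial segments are never
    cut off. *)
Lemma Ext_separator y n : Ext (tree_of (separating_tree y)) (init_seg (separator y) n).
Proof.
apply Ext_unbounded; [apply is_tree_separating|]; intros l.
exists (init_seg (separator y) (n + l)); rewrite in_separating_tree, length_init_seg.
split; [|split; [apply prefix_init_seg|]; lia].
intros m w; rewrite length_init_seg; intros Hm Hy _.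
rewrite nth_init_seg by auto; unfold separator; now rewrite Hy.
Qed.

(** An extension longer than the stage [Nat.div2 w] must respect the enumeration of [n]. Hence
    nothing branches at an enumerated level. *)
Lemma Ext_separating y s n w :
  Ext (tree_of (separating_tree y)) s -> n < length s -> y n = S w ->
  nth n s false = Nat.odd w.
Proof.
intros Hs Hn Hy; apply Ext_unbounded with (n := S (Nat.div2 w)) in Hs;
  [|apply is_tree_separating].
destruct Hs as [t [Ht [Hp Hl]]]; apply in_separating_tree in Ht.
rewrite (prefix_nth s t) by auto; apply prefix_length in Hp; apply Ht; auto; lia.
Qed.

(** Such a value in column 0 constrains no string of length at most [u]. The value 0 is always
    late. *)
Definition late (u v : nat) : Prop := forall w, v = S w -> u <= Nat.div2 w.

Lemma late_stage u b : late u (S (2 * u + Nat.b2n b)).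
Proof.
intros w H; replace w with (2 * u + Nat.b2n b) by lia.
destruct b; cbn [Nat.b2n]; [rewrite Nat.add_1_r, Nat.div2_succ_double|
  rewrite Nat.add_0_r, Nat.div2_double]; auto.
Qed.

(** A string with code below [u] is shorter than [u], so it sees neither positions from [u] on nor
    enumerations at stage [u] or later. *)
Lemma separating_tree_agree u y y' :
  (forall n, n < u -> y n = y' n \/ late u (y n) /\ late u (y' n)) ->
  agree_below u (separating_tree y) (separating_tree y').
Proof.
intros H c Hc; apply char_iff.
assert (Himp : forall y y' s, code s = c ->
  (forall n, n < u -> y n = y' n \/ late u (y n) /\ late u (y' n)) ->
  separating y s -> separating y' s).
{ clear - Hc; intros y y' s Hs H Hy n w Hn Hw Hst; pose proof (length_le_code s).
  destruct (H n) as [E|[_ Hl]]; [lia| |].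
  - apply Hy; auto; congruence.
  - apply Hl in Hw; lia. }
split; intros [s [Hs Hy]]; exists s; split; auto.
- now apply Himp with y.
- apply Himp with y'; auto; intros n Hn; destruct (H n Hn) as [E|[? ?]]; auto.
Qed.

(** Column 0 enters through its tree and not as a graph, so that replacing 0 by a late value is
    invisible to a computation of smaller use. *)
Fixpoint oracle (z : point) (k : nat) : set_nat :=
  match k with
  | 0 => separating_tree (z 0)
  | S k => tjoin (oracle z k) (graph (z (S k)))
  end.

Lemma oracle_agree_below u z z' k :
  (forall n, n < u -> z 0 n = z' 0 n \/ late u (z 0 n) /\ late u (z' 0 n)) ->
  (forall j n, 0 < j <= k -> n < u -> z j n = z' j n) ->
  agree_below u (oracle z k) (oracle z' k).
Proof.
intros H0 HS; induction k as [|k IH].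
- now apply separating_tree_agree.
- intros c Hc; cbn [oracle]; unfold tjoin.
  assert (Hd : Nat.div2 c < u) by (pose proof (Nat.div2_decr c c); lia).
  destruct (Nat.even c).
  + apply IH; auto; intros j n Hj; apply HS; lia.
  + apply graph_agree with u; auto; intros n; apply HS; lia.
Qed.

Lemma eval_oracle_continuous z k t a v :
  eval (oracle z k) t a v ->
  exists L, forall z', agree L z z' -> eval (oracle z' k) t a v.
Proof.
intros He; destruct (eval_use _ _ _ _ He) as [u Hu].
exists (max u (S k)); intros z' Hz; apply Hu, oracle_agree_below.
- intros n Hn; left; apply Hz; lia.
- intros j n Hj Hn; apply Hz; lia.
Qed.

Lemma oracle_le z j k : j <= k -> turing_le (oracle z j) (oracle z k).
Proof.
intros H; induction H as [|k H IH]; [apply turing_le_refl|].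
apply turing_le_trans with (oracle z k); auto; apply turing_le_tjoin_l.
Qed.

Definition tree_model (z : point) (Y : set_nat) : Prop :=
  exists k, turing_le Y (oracle z k).

Lemma turing_ideal_model z : turing_ideal (tree_model z).
Proof.
split; [|split].
- exists (oracle z 0), 0; apply turing_le_refl.
- intros X Y [j HX] [k HY]; exists (max j k).
  apply tjoin_le;
    [apply turing_le_trans with (oracle z j)|apply turing_le_trans with (oracle z k)];
    auto; apply oracle_le; lia.
- intros X Y [k HX] HY; exists k; now apply turing_le_trans with X.
Qed.

(** * Avoiding paths and bounds for the separating tree *)

Section Requirements.

Variable k : nat.
Variable t : rterm.

(** Quantifying over the whole neighbourhood makes the requirement open, so it survives in the
    limit. *)
Definition avoids_path (L : nat) (z : point) : Prop :=
  forall z', agree L z z' -> ~ exists P : set_nat,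
    (forall n, eval (oracle z' k) t [n] (if P n then 1 else 0)) /\
    (forall n, tree_of (oracle z' 0) (init_seg P n)).

(** Either no point near [z0] lets [t] output a bit at [L], or one does, and then [L], still
    undecided, is enumerated on the opposite side too late to affect that computation. *)
Lemma avoids_path_dense L z :
  exists L' z', L <= L' /\ agree L z z' /\ avoids_path L' z'.
Proof.
(* Entry [L] of column 0 lies outside the fixed square, so it may be made undecided. *)
set (z0 := update z 0 L 0).
assert (H0 : agree L z z0) by (now apply agree_update).
destruct (classic (exists z' b, agree (S L) z0 z' /\
  eval (oracle z' k) t [L] (if b : bool then 1 else 0))) as [[z' [b [Hz' He]]]|Hno].
- destruct (eval_use _ _ _ _ He) as [u Hu].
  (* This encodes stage [u] and the value opposite to [b]. *)
  set (v := 2 * u + Nat.b2n (negb b)); set (z'' := update z' 0 L (S v)).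
  assert (He' : eval (oracle z'' k) t [L] (if b then 1 else 0)).
  { apply Hu, oracle_agree_below.
    - intros n _; unfold z''; destruct (Nat.eq_dec n L) as [->|Hn].
      + right; rewrite update_same; split; [|apply late_stage].
        rewrite <- Hz' by lia; unfold z0; rewrite update_same; now intros w.
      + left; symmetry; apply update_other; auto.
    - intros j n Hj _; symmetry; apply update_other; lia. }
  destruct (eval_oracle_continuous _ _ _ _ _ He') as [L' HL'].
  exists (max L' (S L)), z''; split; [lia|]; split.
  + apply agree_trans with L z'; [auto| |now apply agree_update].
    apply agree_trans with (S L) z0; auto.
  + intros z3 Hz3 [P [HP Hpath]].
    assert (E : P L = b).
    { specialize (HP L); apply eval_fun with (w := if b then 1 else 0) in HP.
      - now destruct (P L), b.
      - apply HL'; intros j n Hj Hn; apply Hz3; lia. }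
    specialize (Hpath (S (max L (Nat.div2 v)))); apply in_separating_tree in Hpath.
    specialize (Hpath L v); rewrite length_init_seg, nth_init_seg, E in Hpath by lia.
    specialize (Hpath ltac:(lia)).
    rewrite <- Hz3 in Hpath by lia; unfold z'' in Hpath; rewrite update_same in Hpath.
    specialize (Hpath eq_refl ltac:(lia)).
    unfold v in Hpath; rewrite Nat.odd_add, Nat.odd_mul in Hpath; now destruct b.
- exists (S L), z0; split; [lia|]; split; auto.
  intros z' Hz' [P [HP _]]; apply Hno; eauto.
Qed.

Definition avoids_bound (L : nat) (z : point) : Prop :=
  forall z', agree L z z' -> ~ exists (G : set_nat) f,
    (forall c, eval (oracle z' k) t [c] (if G c then 1 else 0)) /\
    (forall n m, G (pair n m) = true <-> f n = m) /\
    (forall s, Ext (tree_of (oracle z' 0)) s ->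
       exists r, Br (tree_of (oracle z' 0)) r /\ prefix s r /\ length r <= f (length s)).

(** A bound must answer 1 at some [pair L m]. Once it does, all undecided numbers from [L] on are
    enumerated late, which rules out branching at levels from [L] to [m]. *)
Lemma avoids_bound_dense L z :
  exists L' z', L <= L' /\ agree L z z' /\ avoids_bound L' z'.
Proof.
destruct (classic (exists z' m, agree L z z' /\
  eval (oracle z' k) t [pair L m] 1)) as [[z' [m [Hz' He]]]|Hno].
- destruct (eval_use _ _ _ _ He) as [u Hu].
  set (late_v := S (2 * u + Nat.b2n false)).
  set (z'' := (fun j n => if (j =? 0) && (L <=? n) && (z' 0 n =? 0)
                          then late_v else z' j n) : point).
  assert (Hz'' : agree L z' z'').
  { intros j n Hj Hn; unfold z''; destruct (Nat.leb_spec L n); [lia|].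
    now rewrite andb_false_r. }
  assert (He' : eval (oracle z'' k) t [pair L m] 1).
  { apply Hu, oracle_agree_below.
    - intros n _; unfold z''; simpl.
      destruct (L <=? n); simpl; auto.
      destruct (Nat.eqb_spec (z' 0 n) 0) as [E|]; auto.
      right; split; [rewrite E; now intros w|apply late_stage].
    - intros j n Hj _; unfold z''; destruct j; [lia|auto]. }
  destruct (eval_oracle_continuous _ _ _ _ _ He') as [L' HL'].
  (* [S m] keeps column 0 fixed up to entry [m] throughout the neighbourhood. *)
  exists (max L' (max (S m) L)), z''; split; [lia|]; split.
  + now apply agree_trans with L z'.
  + intros z3 Hz3 [G [f [HG [Hf Hbound]]]].
    assert (E : f L = m).
    { apply Hf; specialize (HG (pair L m)).
      apply eval_fun with (w := 1) in HG.
      - now destruct (G (pair L m)).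
      - apply HL'; intros j n Hj Hn; apply Hz3; lia. }
    destruct (Hbound (init_seg (separator (z3 0)) L) (Ext_separator (z3 0) L))
      as [r [[_ [Hr0 Hr1]] [Hp Hl]]].
    apply prefix_length in Hp; rewrite length_init_seg in *.
    rewrite E in Hl.
    assert (Hw : exists w, z3 0 (length r) = S w).
    { rewrite <- Hz3 by lia; unfold z''; simpl.
      destruct (Nat.leb_spec L (length r)); [simpl|lia].
      destruct (z' 0 (length r)) eqn:E0; simpl; eauto; unfold late_v; eauto. }
    destruct Hw as [w Hw].
    apply Ext_separating with (n := length r) (w := w) in Hr0, Hr1; auto;
      try (rewrite length_app; simpl; lia).
    rewrite nth_middle in Hr0, Hr1; congruence.
- exists L, z; split; [lia|]; split; [apply agree_refl|].
  intros z' Hz' [G [f [HG [Hf _]]]]; apply Hno; exists z', (f L); split; auto.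
  specialize (HG (pair L (f L))); now rewrite (proj2 (Hf L (f L)) eq_refl) in HG.
Qed.

(** * Escaping the branching of trees computable from the earlier oracles *)

(** Phrased by halting computations, this makes sense at points where [t] is not total, and finitely
    many computations witness it. *)
Definition dead_end (z : point) (s : list bool) : Prop :=
  exists l, forall r, length r = l -> eval (oracle z k) t [code (s ++ r)] 0.

Lemma dead_end_agree z z' s :
  (forall j n, j <= k -> z j n = z' j n) -> dead_end z s -> dead_end z' s.
Proof.
intros H [l Hl]; exists l; intros r Hr.
apply eval_agree with (oracle z k); auto; intros c.
apply (oracle_agree_below (S c)); auto; intros; try left; apply H; lia.
Qed.

(** In a tree, a level that is empty above [s] bounds the length of all extensions of [s]. *)
Lemma dead_end_spec z X s :
  is_tree (tree_of X) ->
  (forall c, eval (oracle z k) t [c] (if X c then 1 else 0)) ->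
  Ext (tree_of X) s <-> ~ dead_end z s.
Proof.
intros HT HX; rewrite Ext_unbounded by auto; split.
- intros H [l Hl]; destruct (H (length s + l)) as [u [Hu [[r ->] Hle]]].
  rewrite length_app in Hle.
  assert (Hr : length (firstn l r) = l) by (rewrite length_firstn; lia).
  apply Hl in Hr; specialize (HX (code (s ++ firstn l r))).
  apply (eval_fun _ _ _ _ HX) in Hr.
  assert (Ht : tree_of X (s ++ firstn l r)).
  { apply (HT _ _ Hu); exists (skipn l r); now rewrite <- app_assoc, firstn_skipn. }
  unfold tree_of in Ht; now rewrite Ht in Hr.
- intros H n; apply NNPP; intros Hn; apply H; exists n; intros r Hr.
  specialize (HX (code (s ++ r))); destruct (X (code (s ++ r))) eqn:E; auto.
  exfalso; apply Hn; exists (s ++ r); repeat split; auto; [now exists r|].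
  rewrite length_app; lia.
Qed.

Definition decides_dead_end (s : list bool) (L : nat) (z : point) : Prop :=
  (forall z', agree L z z' -> dead_end z' s) \/
  (forall z', agree L z z' -> ~ dead_end z' s).

(** A dead end rests on finitely many computations, hence persists on a neighbourhood; if no nearby
    point has one, its absence is already forced. *)
Lemma decides_dead_end_dense s L z :
  exists L' z', L <= L' /\ agree L z z' /\ decides_dead_end s L' z'.
Proof.
destruct (classic (exists z', agree L z z' /\ dead_end z' s)) as [[z' [Hz' [l Hl]]]|Hno].
- destruct (uniform_bound_list _ (fun r u => forall z'', agree u z' z'' ->
    eval (oracle z'' k) t [code (s ++ r)] 0) (strings l)) as [L' HL'].
  + intros r u u' Hu H z'' Hz''; apply H; intros j n Hj Hn; apply Hz''; lia.
  + intros r Hr; apply in_strings in Hr; apply eval_oracle_continuous; auto.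
  + exists (max L L'), z'; split; [lia|]; split; auto.
    left; intros z'' Hz''; exists l; intros r Hr; apply HL'; [now apply in_strings|].
    intros j n Hj Hn; apply Hz''; lia.
- exists L, z; split; [lia|]; split; [apply agree_refl|].
  right; intros z' Hz' Hd; eauto.
Qed.

Definition forces_branching (L : nat) (z : point) (n m : nat) : Prop :=
  exists ls, NoDup ls /\ length ls = n /\ forall l, In l ls -> l < m /\
    exists s, length s = l /\
      forall b z', agree L z z' -> ~ dead_end z' (s ++ [b]).

(** Either [z (S k) n] lies above [n] forced branching levels, or no refinement of the neighbourhood
    ever forces [n] of them under any bound. Letting [x] vary yields infinitely many such [n]. *)
Definition escapes (x L : nat) (z : point) : Prop :=
  exists n, x <= n /\
    (n < L /\ S k < L /\ forces_branching L z n (z (S k) n) \/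
     forall L' z' m, L <= L' -> agree L z z' -> ~ forces_branching L' z' n m).

Lemma escapes_mono x L L' z z' :
  L <= L' -> agree L z z' -> escapes x L z -> escapes x L' z'.
Proof.
intros HL Hz [n [Hx H]]; exists n; split; auto.
destruct H as [[Hn [Hk [ls [Hnd [Hlen Hls]]]]]|H].
- left; split; [lia|]; split; [lia|]; exists ls; repeat split; auto.
  + rewrite <- Hz by auto; now apply Hls.
  + destruct (Hls l) as [_ [s [Hs Hd]]]; auto; exists s; split; auto.
    intros b z'' Hz''; apply Hd; now apply agree_trans with L' z'.
- right; intros L'' z'' m HL' Hz'; apply H; [lia|now apply agree_trans with L' z'].
Qed.

(* Branching of the tree does not depend on column [S k], whose value at [n] may
   therefore be chosen after a bound on the branching has been forced. *)
Lemma escapes_dense x L z :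
  exists L' z', L <= L' /\ agree L z z' /\ escapes x L' z'.
Proof.
(* [L <= n] leaves entry [n] of column [S k] free. *)
set (n := max x L).
destruct (classic (exists L' z' m, L <= L' /\ agree L z z' /\ forces_branching L' z' n m))
  as [[L' [z' [m [HL [Hz' [ls [Hnd [Hlen Hls]]]]]]]]|Hno].
- set (z'' := update z' (S k) n m).
  exists (S (max L' (max n (S k)))), z''; split; [lia|]; split.
  + apply agree_trans with L z'; auto; apply agree_update; lia.
  + exists n; split; [lia|]; left; split; [lia|]; split; [lia|].
    exists ls; repeat split; auto.
    * unfold z''; rewrite update_same; now apply Hls.
    * destruct (Hls l) as [_ [s [Hs Hd]]]; auto; exists s; split; auto.
      intros b z3 Hz3 Hdead.
      (* Restoring the old entry gives a point in the neighbourhood of [z'] with unchanged columns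
         up to [k], hence with the same dead ends. *)
      apply (Hd b (update z3 (S k) n (z' (S k) n))).
      -- intros j i Hj Hi.
         destruct (Nat.eq_dec j (S k)) as [->|Hjk], (Nat.eq_dec i n) as [->|Hin];
           [now rewrite update_same|..];
           rewrite update_other, <- Hz3 by lia; unfold z''; now rewrite update_other by lia.
      -- apply dead_end_agree with z3; auto.
         intros j i Hj; symmetry; apply update_other; lia.
- exists L, z; split; [lia|]; split; [apply agree_refl|].
  exists n; split; [lia|]; right; intros L' z' m HL Hz' H; apply Hno; eauto 10.
Qed.

End Requirements.

(** * The generic point and its ideal *)

Definition requirement (kind k : nat) (t : rterm) (x L : nat) (z : point) : Prop :=
  match kind with
  | 0 => avoids_path k t L z
  | 1 => avoids_bound k t L z
  | 2 => exists s, code s = x /\ decides_dead_end k t s L z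
  | _ => escapes k t x L z
  end.

(** Terms are countable, so all instances of the requirements are listed by coding quadruples as
    numbers. *)
Lemma generic_exists :
  exists z, forall kind k t x, exists L, requirement kind k t x L z.
Proof.
destruct rterm_countable as [e He].
destruct (baire_category (fun i =>
  let (kind, i) := of_nat i in let (k, i) := of_nat i in let (c, x) := of_nat i in
  requirement kind k (e c) x)) as [z Hz].
- intros i L L' z z' HL Hz.
  destruct (of_nat i) as [kind j], (of_nat j) as [k h], (of_nat h) as [c x].
  assert (Htr : forall z'', agree L' z' z'' -> agree L z z'')
    by (intros z''; now apply agree_trans).
  destruct kind as [|[|[|kind]]]; simpl.
  + intros H z'' Hz''; auto.
  + intros H z'' Hz''; apply H; auto.
  + intros [s [Hs [H|H]]]; exists s; split; auto; [left|right]; auto.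
  + now apply escapes_mono.
- intros i L z.
  destruct (of_nat i) as [kind j], (of_nat j) as [k h], (of_nat h) as [c x].
  destruct kind as [|[|[|kind]]]; simpl.
  + apply avoids_path_dense.
  + apply avoids_bound_dense.
  + destruct (code_surj x) as [s Hs].
    destruct (decides_dead_end_dense k (e c) s L z) as [L' [z' [? []]]].
    exists L', z'; eauto.
  + apply escapes_dense.
- exists z; intros kind k t x; destruct (He t) as [c <-].
  specialize (Hz (to_nat (kind, to_nat (k, to_nat (c, x))))).
  now rewrite !cancel_of_to in Hz.
Qed.

Theorem mainTheorem9 :
  exists M : set_nat -> Prop, turing_ideal M /\ VSMALL_in M /\ ~ DIM_in M.
Proof.
destruct generic_exists as [z Hz].
exists (tree_model z); split; [apply turing_ideal_model|split].
- intros X [k [t Ht]] Hinf Hf.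
  destruct (path_or_unbounded_branching X Hinf) as [[P [HP Hpath]]|Hbr].
  { exists P; split; auto; exists k; apply turing_le_trans with X; auto; now exists t. }
  destruct Hinf as [HT _].
  (* [X] is computable from the columns up to [k]; the next column is in the ideal and serves as the
     excluded function. *)
  exfalso; apply Hf; exists (z (S k)); split.
  { exists (graph (z (S k))); split; [|apply graph_spec].
    exists (S k); apply turing_le_tjoin_r. }
  intros x; destruct (Hz 3 k t x) as [L [n [Hx [[_ [_ Hfb]]|Hno]]]]; exists n; split; auto.
  + destruct Hfb as [ls [Hnd [Hlen Hls]]]; exists ls; repeat split; auto.
    * now apply Hls.
    * destruct (Hls l) as [_ [s [Hs Hd]]]; auto; exists s; split; auto.
      assert (HE : forall b, Ext (tree_of X) (s ++ [b])).
      { intros b; apply (dead_end_spec k t z); auto; apply Hd, agree_refl. }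
      split; [|auto]; destruct (HE true) as [Hs1 _]; apply (HT _ _ Hs1); now exists [true].
  (* There are [n] branching levels, and genericity turns the extendibility of the children into
     facts about a neighbourhood of [z]. So [n] levels are forced after all. *)
  + destruct (Hbr n) as [m [ls [Hnd [Hlen Hls]]]].
    destruct (uniform_bound_list _ (fun l L' => l < m /\ exists s, length s = l /\
      forall b z', agree L' z z' -> ~ dead_end k t z' (s ++ [b])) ls) as [L' HL'].
    * intros l u u' Hu [Hl [s [Hs H]]]; split; auto; exists s; split; auto.
      intros b z' Hz'; apply H; intros j i Hj Hi; apply Hz'; lia.
    * intros l Hl; destruct (Hls l Hl) as [Hm [s [[_ [H0 H1]] Hs]]].
      assert (Hd : forall b, exists L', forall z', agree L' z z' ->
        ~ dead_end k t z' (s ++ [b])).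
      { intros b; destruct (Hz 2 k t (code (s ++ [b]))) as [L' [s' [Hs' HD]]].
        apply code_inj in Hs'; subst s'; exists L'.
        (* A forced dead end would hold at [z] itself, where this child is extendible. *)
        destruct HD as [HD|HD]; auto; exfalso.
        specialize (HD z (agree_refl L' z)); revert HD.
        apply (dead_end_spec k t z X); auto; now destruct b. }
      destruct (Hd false) as [L0 HL0], (Hd true) as [L1 HL1].
      exists (max L0 L1); split; auto; exists s; split; auto.
      intros [] z' Hz'; [apply HL1|apply HL0]; intros j i Hj Hi; apply Hz'; lia.
    * exfalso; apply (Hno (max L L') z m); [lia|apply agree_refl|].
      exists ls; repeat split; auto; [now apply HL'|].
      destruct (HL' l) as [_ [s [Hs Hd]]]; auto; exists s; split; auto.
      intros b z' Hz'; apply Hd; intros j i Hj Hi; apply Hz'; lia.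
(* DIM is refuted by the tree of column 0, which is infinite because of its separator and by
   genericity has neither a path nor a bound in the ideal. *)
- intros HDIM; destruct (HDIM (oracle z 0)) as [P [[k [t Ht]] HP]].
  + exists 0; apply turing_le_refl.
  + split; [apply is_tree_separating|].
    apply infinite_strs_unbounded; intros n.
    exists (init_seg (separator (z 0)) n); rewrite length_init_seg.
    split; auto; apply Ext_separator.
  + intros [f [[G [[k [t Ht]] HG]] Hf]].
    destruct (Hz 1 k t 0) as [L HL]; apply (HL z (agree_refl L z)); eauto.
  + destruct (Hz 0 k t 0) as [L HL]; apply (HL z (agree_refl L z)); eauto.
Qed.
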